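(* For any $x\colon E\to\mathbb{Q}_+$, the biset function $f^{\kappa}_x$ defined by $f^{\kappa}_x(\hat{X})=f^{\kappa}(\hat{X})-x(\delta(\hat{X}))$ for $\hat{X}\in\mathcal{V}$ is skew supermodular.
   Context: Let $G=(V,E)$ be an undirected graph, $T\subseteq V$, and $r\colon T\to\mathbb{Z}_+$. A biset is an ordered pair $\hat{X}=(X,X^+)$ with $X\subseteq X^+\subseteq V$; $\Gamma(\hat{X})=X^+\setminus X$. $\mathcal{V}$ is the family of bisets with nonempty inner part $X$. For bisets, $\hat{X}\cap\hat{Y}=(X\cap Y,X^+\cap Y^+)$, $\hat{X}\cup\hat{Y}=(X\cup Y,X^+\cup Y^+)$, $\hat{X}\setminus\hat{Y}=(X\setminus Y^+,X^+\setminus Y)$. For $\hat{X}\in\mathcal{V}$, $\delta(\hat{X})$ is the set of edges of $E$ with one end in $X$ and the other in $V\setminus X^+$, and $x(E')=\sum_{e\in E'}x(e)$. For $t\in T$, $\mathcal{C}(t)=\{\hat{X}\in\mathcal{V}: X\cap T=X^+\cap T=\{t\}\}$. Define $f^{\kappa}(\hat{X})=r(t)-|\Gamma(\hat{X})|$ if $\hat{X}\in\mathcal{C}(t)$ for some $t\in T$, and $f^{\kappa}(\hat{X})=0$ otherwise. A biset function $h$ on $\mathcal{V}$ is skew supermodular if for all $\hat{X},\hat{Y}\in\mathcal{V}$ with $h(\hat{X})>0$ and $h(\hat{Y})>0$, either $h(\hat{X})+h(\hat{Y})\le h(\hat{X}\cap\hat{Y})+h(\hat{X}\cup\hat{Y})$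 or $h(\hat{X})+h(\hat{Y})\le h(\hat{X}\setminus\hat{Y})+h(\hat{Y}\setminus\hat{X})$ (with the convention that the relevant bisets lie in $\mathcal{V}$ where the function is evaluated). *)

(* Defs.v *)
From HB Require Import structures.
From mathcomp Require Import all_boot all_order all_algebra.

Set Implicit Arguments.
Unset Strict Implicit.
Unset Printing Implicit Defensive.

Import Order.TTheory GRing.Theory Num.Theory.
Local Open Scope ring_scope.

(* Finite undirected graphs; parallel edges and loops are allowed, the set of
   ends of a loop being a singleton. *)
Record ugraph := UGraph {
  node : finType;
  edge : finType;
  ends : edge -> {set node};
  endsP : forall e, (0 < #|ends e| <= 2)%N
}.

Record biset (V : finType) := Biset {
  inner : {set V};
  outer : {set V};
  inner_sub_outer : inner \subset outer
}.

Section BisetOps.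
Variable V : finType.
Implicit Types X Y : biset V.

Definition bisetI X Y : biset V :=
  Biset (setISS (inner_sub_outer X) (inner_sub_outer Y)).

Definition bisetU X Y : biset V :=
  Biset (setUSS (inner_sub_outer X) (inner_sub_outer Y)).

(* (X :\: Y^+, X^+ :\: Y) *)
Definition bisetD X Y : biset V :=
  Biset (setDSS (inner_sub_outer X) (inner_sub_outer Y)).

Definition Gamma X : {set V} := outer X :\: inner X.

(* Membership in the family of bisets with nonempty inner part. *)
Definition proper_biset X : bool := inner X != set0.

(* Membership in C(t). *)
Definition terminal_biset (T : {set V}) (t : V) X : bool :=
  [&& proper_biset X, inner X :&: T == [set t] & outer X :&: T == [set t]].

(* At most one t qualifies, so the choice made by pick is immaterial; only the
   values of r on T matter. *)
Definition fkappa (T : {set V}) (r : V -> nat) X : rat :=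
  if [pick t in T | terminal_biset T t X] is Some t
  then (r t)%:R - #|Gamma X|%:R else 0.

(* h is only meaningful on proper bisets, so each alternative requires that the
   bisets at which it evaluates h are proper. *)
Definition skew_supermodular (h : biset V -> rat) : Prop :=
  forall X Y, proper_biset X -> proper_biset Y -> 0 < h X -> 0 < h Y ->
    [/\ proper_biset (bisetI X Y), proper_biset (bisetU X Y)
      & h X + h Y <= h (bisetI X Y) + h (bisetU X Y)]
    \/
    [/\ proper_biset (bisetD X Y), proper_biset (bisetD Y X)
      & h X + h Y <= h (bisetD X Y) + h (bisetD Y X)].

End BisetOps.

Definition delta (G : ugraph) (X : biset (node G)) : {set edge G} :=
  [set e | [exists u in inner X, exists v in ~: outer X,
              ends e == [set u; v]]].

Definition fkappa_x (G : ugraph) (T : {set node G}) (r : node G -> nat)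
    (x : edge G -> rat) (X : biset (node G)) : rat :=
  fkappa T r X - \sum_(e in delta X) x e.

(* Main.v *)
(** A positive value of [f^kappa_x] forces both bisets to be terminal, say in
    C(s) and C(t).  If s = t, then the intersection and the union are again in
    C(t); if s <> t, then the two differences are in C(s) and C(t), since s is
    outside the outer part of the second biset and conversely.  In either case
    the boundary sizes are modular, and the cut function is submodular, resp.
    posimodular, edge by edge. *)

Require Import Defs.
From mathcomp Require Import all_boot all_order all_algebra.
From mathcomp Require Import lra.
Import Order.TTheory GRing.Theory Num.Theory.
Local Open Scope ring_scope.

Section Bisets.
Set Implicit Arguments.
Unset Strict Implicit.
Variable V : finType.
Implicit Types (X Y : biset V) (T : {set V}) (t : V).

Lemma innerW X v : v \in inner X -> v \in outer X.
Proof. exact: (subsetP (inner_sub_outer X)). Qed.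

(** As [inner X] lies in [outer X], the two set equations and properness reduce to these three
    conditions, which can be checked pointwise for intersections, unions and differences. *)
Lemma terminal_bisetP T t X :
  reflect [/\ t \in T, t \in inner X
            & forall v, v \in T -> v \in outer X -> v = t]
          (terminal_biset T t X).
Proof.
apply: (iffP and3P) => [[_ /eqP/setP inT /eqP/setP outT]|[tT tX outX]].
  have := inT t; rewrite !inE eqxx => /andP[tX tT]; split=> // v vT vX.
  by apply/set1P; rewrite -outT inE vX vT.
split; first by apply/set0Pn; exists t.
- apply/eqP/setP=> v; rewrite !inE.
  apply/andP/eqP => [[vX vT]|->//]; exact: outX _ vT (innerW vX).
- apply/eqP/setP=> v; rewrite !inE.
  by apply/andP/eqP => [[vX vT]|->]; [exact: outX | rewrite innerW].
Qed.

Lemma terminal_biset_proper T t X : terminal_biset T t X -> proper_biset X.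
Proof. by case/and3P. Qed.

Lemma fkappa_terminal T (r : V -> nat) t X :
  terminal_biset T t X -> fkappa T r X = (r t)%:R - #|Gamma X|%:R.
Proof.
move=> tX; have [tT tin outX] := terminal_bisetP _ _ _ tX.
(* The terminal [u] chosen by [pick] lies in the inner, hence the outer part, so it equals [t]. *)
rewrite /fkappa; case: pickP => [u /andP[uT /terminal_bisetP[_ uin _]]|/(_ t)].
  by rewrite (outX u uT (innerW uin)).
by rewrite tT tX.
Qed.

Lemma fkappa_gt0_terminal T (r : V -> nat) X :
  0 < fkappa T r X -> exists t, terminal_biset T t X.
Proof.
rewrite /fkappa; case: pickP => [t /andP[_ tX] _|_]; first by exists t.
by rewrite ltxx.
Qed.

Lemma terminal_bisetI T t X Y : terminal_biset T t X ->
  terminal_biset T t Y -> terminal_biset T t (bisetI X Y).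
Proof.
move=> /terminal_bisetP[tT tX outX] /terminal_bisetP[_ tY _].
apply/terminal_bisetP; split=> // [|v vT]; rewrite !inE ?tX //.
by case/andP=> /(outX _ vT).
Qed.

Lemma terminal_bisetU T t X Y : terminal_biset T t X ->
  terminal_biset T t Y -> terminal_biset T t (bisetU X Y).
Proof.
move=> /terminal_bisetP[tT tX outX] /terminal_bisetP[_ tY outY].
apply/terminal_bisetP; split=> // [|v vT]; rewrite !inE ?tX //.
by case/orP=> [/(outX _ vT)|/(outY _ vT)].
Qed.

(** The only terminal in [outer Y] is [t], so [s] survives the removal of [outer Y] from
    [inner X]. *)
Lemma terminal_bisetD T s t X Y : s != t -> terminal_biset T s X ->
  terminal_biset T t Y -> terminal_biset T s (bisetD X Y).
Proof.
move=> st /terminal_bisetP[sT sX outX] /terminal_bisetP[_ _ outY].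
apply/terminal_bisetP; split=> // [|v vT]; rewrite !inE.
  by rewrite sX andbT; apply: contra st => /(outY _ sT) ->.
by case/andP=> _ /(outX _ vT).
Qed.

(** Indicator sums reduce the boundary identities to a check at each single node. *)
Lemma cardE_sum (A : {set V}) : #|A| = (\sum_v (v \in A))%N.
Proof. by rewrite -sum1_card big_mkcond; apply: eq_bigr => v _; case: in_mem. Qed.

Lemma card_GammaIU X Y :
  (#|Gamma (bisetI X Y)| + #|Gamma (bisetU X Y)| = #|Gamma X| + #|Gamma Y|)%N.
Proof.
rewrite !cardE_sum -!big_split; apply: eq_bigr => v _; rewrite /Gamma /= !inE.
(* The inclusions of inner in outer parts, as boolean implications, discard the impossible rows of
   the truth table. *)
have /implyP := @innerW X v; have /implyP := @innerW Y v.
by do 4 case: (v \in _).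
Qed.

Lemma card_GammaD X Y :
  (#|Gamma (bisetD X Y)| + #|Gamma (bisetD Y X)| = #|Gamma X| + #|Gamma Y|)%N.
Proof.
rewrite !cardE_sum -!big_split; apply: eq_bigr => v _; rewrite /Gamma /= !inE.
have /implyP := @innerW X v; have /implyP := @innerW Y v.
by do 4 case: (v \in _).
Qed.

End Bisets.

Section Cuts.
Set Implicit Arguments.
Unset Strict Implicit.
Variable G : ugraph.
Implicit Types (X Y : biset (node G)) (e : edge G).

(** A loop is covered by taking [u] and [v] equal. *)
Lemma ends_pair e : exists u v, ends e = [set u; v].
Proof.
have /andP[] := endsP e; rewrite leq_eqVlt => /orP[|].
  by rewrite eq_sym => /cards1P[u ->] _; exists u, u; rewrite setUid.
move=> e1 e2; have /cards2P[u [v [_ ->]]] : #|ends e| == 2%N by rewrite eqn_leq e2.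
by exists u, v.
Qed.

Lemma in_delta e X u v : ends e = [set u; v] ->
  (e \in delta X) = (u \in inner X) && (v \notin outer X)
                 || (v \in inner X) && (u \notin outer X).
Proof.
move=> euv; rewrite inE euv; apply/existsP/idP.
  case=> a /andP[aX /existsP[b /andP[]]]; rewrite inE => bX /eqP/setP eab.
  have := eab u; have := eab v; have := eab a; have := eab b.
  rewrite !inE !eqxx !orbT /=.
  (* If [a] and [b] are the same end, it would be inside [inner X] and outside [outer X]; the other
     two cases are the two disjuncts. *)
  move=> /orP[]/eqP eb /orP[]/eqP ea; move: aX bX; rewrite ea eb.
  - by move=> /innerW->.
  - by move=> -> -> *; rewrite orbT.
  - by move=> -> ->.
  - by move=> /innerW->.
case/orP=> /andP[aX bX]; [exists u | exists v]; rewrite aX /=; apply/existsP.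
  by exists v; rewrite inE bX eqxx.
by exists u; rewrite inE bX setUC eqxx.
Qed.

(** Only the positions of the two ends relative to the inner and outer parts matter, which leaves a
    finite check. *)
Lemma in_delta_submod e X Y :
  ((e \in delta (bisetI X Y)) + (e \in delta (bisetU X Y))
     <= (e \in delta X) + (e \in delta Y))%N.
Proof.
have [u [v euv]] := ends_pair e; rewrite !(in_delta _ euv) /= !inE.
have /implyP := @innerW _ X u; have /implyP := @innerW _ Y u.
have /implyP := @innerW _ X v; have /implyP := @innerW _ Y v.
by do 4 case: (u \in _); do 4 case: (v \in _).
Qed.

Lemma in_delta_posimod e X Y :
  ((e \in delta (bisetD X Y)) + (e \in delta (bisetD Y X))
     <= (e \in delta X) + (e \in delta Y))%N.
Proof.
have [u [v euv]] := ends_pair e; rewrite !(in_delta _ euv) /= !inE.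
have /implyP := @innerW _ X u; have /implyP := @innerW _ Y u.
have /implyP := @innerW _ X v; have /implyP := @innerW _ Y v.
by do 4 case: (u \in _); do 4 case: (v \in _).
Qed.

Variables (x : edge G -> rat) (x_ge0 : forall e : edge G, 0 <= x e).

(** Each edge contributes its weight times its multiplicity, and nonnegative weights preserve the
    inequality of multiplicities. *)
Lemma ler_sum_sets (A B C D : {set edge G}) :
  (forall e, (e \in A) + (e \in B) <= (e \in C) + (e \in D))%N ->
  \sum_(e in A) x e + \sum_(e in B) x e
    <= \sum_(e in C) x e + \sum_(e in D) x e.
Proof.
have sumE (S : {set edge G}) : \sum_(e in S) x e = \sum_e x e *+ (e \in S).
  by rewrite big_mkcond; apply: eq_bigr => e _; case: in_mem.
move=> leABCD; rewrite !sumE -!big_split; apply: ler_sum => e _ /=.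
by rewrite -!mulrnDr; apply: ler_wpMn2l.
Qed.

(** The subtracted cut weight is nonnegative, so [fkappa] itself is positive. *)
Lemma fkappa_x_gt0_terminal T (r : node G -> nat) X :
  0 < fkappa_x T r x X -> exists t, terminal_biset T t X.
Proof.
rewrite subr_gt0 => fX; apply: (fkappa_gt0_terminal (r := r)).
by apply: le_lt_trans fX; apply: sumr_ge0.
Qed.

End Cuts.

Theorem theorem3 (G : ugraph) (T : {set node G}) (r : node G -> nat)
    (x : edge G -> rat) (x_ge0 : forall e : edge G, 0 <= x e) :
  skew_supermodular (fkappa_x T r x).
Proof.
move=> X Y _ _ /(fkappa_x_gt0_terminal x_ge0)[s sX].
move=> /(fkappa_x_gt0_terminal x_ge0)[t tY].
have [est|st] := eqVneq s t; [left; move: sX; rewrite est => tX | right].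
  have tI := terminal_bisetI tX tY.
  have tU := terminal_bisetU tX tY.
  split; [exact: terminal_biset_proper tI | exact: terminal_biset_proper tU |].
  rewrite /fkappa_x (fkappa_terminal _ tX) (fkappa_terminal _ tY).
  rewrite (fkappa_terminal _ tI) (fkappa_terminal _ tU).
  have := ler_sum_sets x_ge0 (fun e => in_delta_submod e X Y).
  (* Cast to [rat], the boundary identity cancels the cardinalities; the terms in [r t] agree, and
     the cut inequality remains. *)
  have /(congr1 (fun n => n%:R : rat)) := card_GammaIU X Y.
  by rewrite !natrD; lra.
have sD := terminal_bisetD st sX tY.
have tD : terminal_biset T t (bisetD Y X).
  by apply: terminal_bisetD tY sX; rewrite eq_sym.
split; [exact: terminal_biset_proper sD | exact: terminal_biset_proper tD |].
rewrite /fkappa_x (fkappa_terminal _ sX) (fkappa_terminal _ tY).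
rewrite (fkappa_terminal _ sD) (fkappa_terminal _ tD).
have := ler_sum_sets x_ge0 (fun e => in_delta_posimod e X Y).
have /(congr1 (fun n => n%:R : rat)) := card_GammaD X Y.
by rewrite !natrD; lra.
Qed.
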